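(* Let $i,j\in\{2,3,4,5\}$ with $i\ne j$ and $\{i,j\}\notin\{\{2,5\},\{3,4\}\}$, and let $A\in\mathsf{L}_1\oplus\mathsf{L}_i\oplus\mathsf{L}_j$ be an orthogonal matrix. Then $A\in\mathcal{OP}_4$.
   Context: For a permutation $\sigma$ of $\{1,2,3,4\}$, $P_\sigma$ is the permutation matrix with $(i,j)$ entry $1$ if $\sigma(i)=j$ and $0$ otherwise. $\mathcal{OP}_4$ is the set of $4\times4$ matrices $A$ with $A^TA=I$ that are permutative (each row is a permutation of any other row). $\mathsf{L}_k$ ($k=1,\ldots,5$) is the real span of $\mathcal{B}_k$, where $\mathcal{B}_1=\{P_{(12)},P_{(34)},P_{(13)(24)},P_{(14)(23)}\}$, $\mathcal{B}_2=\{P_{(24)},P_{(12)(34)}\}$, $\mathcal{B}_3=\{P_{(124)},P_{(234)}\}$, $\mathcal{B}_4=\{P_{(123)}\}$, $\mathcal{B}_5=\{P_{(23)}\}$. The union of the $\mathcal{B}_k$ is a basis of the $10$-dimensional real space of linear combinations of $4\times4$ permutation matrices, so sums of distinct $\mathsf{L}_k$ are direct. Cycles such as $(124)$ mean $1\mapsto2\mapsto4\mapsto1$. *)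

(* Defs.v *)
From HB Require Import structures.
From mathcomp Require Import all_boot all_order all_fingroup all_algebra.
From mathcomp Require Import reals.

Set Implicit Arguments.
Unset Strict Implicit.
Unset Printing Implicit Defensive.

Import GroupScope GRing.Theory.
Local Open Scope ring_scope.

(* p1, p2, p3, p4 stand for the points 1, 2, 3, 4 permuted in the paper. *)
Definition p1 : 'I_4 := @Ordinal 4 0 isT.
Definition p2 : 'I_4 := @Ordinal 4 1 isT.
Definition p3 : 'I_4 := @Ordinal 4 2 isT.
Definition p4 : 'I_4 := @Ordinal 4 3 isT.

(* The cycle a |-> b |-> c |-> a; permutations compose left to right, i.e.
   (s * t) x = t (s x). *)
Definition cyc3 (a b c : 'I_4) : 'S_4 := (tperm a b * tperm a c)%g.

Lemma cyc3P (a b c : 'I_4) : uniq [:: a; b; c] ->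
  [/\ cyc3 a b c a = b, cyc3 a b c b = c, cyc3 a b c c = a
    & forall x, x \notin [:: a; b; c] -> cyc3 a b c x = x].
Proof.
rewrite /= !inE negb_or !andbT => /andP[/andP[nab nac] nbc].
split=> [||| x]; rewrite ?inE ?negb_or !permM.
- by rewrite tpermL tpermD // eq_sym.
- by rewrite tpermR tpermL.
- by rewrite (tpermD nac nbc) tpermR.
- by case/and3P=> na nb nc; rewrite !tpermD // eq_sym.
Qed.

(* B_k is given by its permutations: the matrix P_sigma, with (i, j) entry 1
   iff sigma i = j, is exactly perm_mx sigma (see perm_mxE below). *)
Definition Bperms (k : nat) : seq 'S_4 :=
  match k with
  | 1 => [:: tperm p1 p2; tperm p3 p4;
             (tperm p1 p3 * tperm p2 p4)%g; (tperm p1 p4 * tperm p2 p3)%g]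
  | 2 => [:: tperm p2 p4; (tperm p1 p2 * tperm p3 p4)%g]
  | 3 => [:: cyc3 p1 p2 p4; cyc3 p2 p3 p4]
  | 4 => [:: cyc3 p1 p2 p3]
  | 5 => [:: tperm p2 p3]
  | _ => [::]
  end.

Lemma perm_mxE (R : realType) (s : 'S_4) (i j : 'I_4) :
  (perm_mx s : 'M[R]_4) i j = (s i == j)%:R.
Proof. by rewrite !mxE. Qed.

Definition L (R : realType) (k : nat) : {vspace 'M[R]_4} :=
  <<[seq (perm_mx s : 'M[R]_4) | s <- Bperms k]>>%VS.

Definition orthogonal_mx (R : realType) (A : 'M[R]_4) : Prop :=
  A^T *m A = 1%:M.

Definition permutative (R : realType) (A : 'M[R]_4) : Prop :=
  forall i j : 'I_4, exists s : 'S_4, row i A = col_perm s (row j A).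

Definition OP4 (R : realType) (A : 'M[R]_4) : Prop :=
  orthogonal_mx A /\ permutative A.

(* Main.v *)
(* Orthogonality enters only through its weakest consequence: all rows and all
   columns of A have the same Euclidean norm. In the coordinates of the basis,
   the differences of these norms factor into products of linear forms (or do so
   after a few substitutions), so A lies in a finite union of linear subspaces,
   and on each of them the rows are visibly permutations of one another. *)
Require Import Defs.
From mathcomp Require Import all_boot all_order all_fingroup all_algebra.
From mathcomp Require Import reals.
From mathcomp Require Import ring lra.

Set Implicit Arguments.
Unset Strict Implicit.
Unset Printing Implicit Defensive.

Import GRing.Theory Num.Theory.
Local Open Scope ring_scope.

(** * Norm equations and matching of rows *)

Definition unit_lines (R : realType) (x11 x12 x13 x14 x21 x22 x23 x24
    x31 x32 x33 x34 x41 x42 x43 x44 : R) : Prop :=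
  let unit4 (x y z t : R) := x * x + y * y + z * z + t * t = 1 in
  [/\ unit4 x11 x12 x13 x14, unit4 x21 x22 x23 x24,
      unit4 x31 x32 x33 x34 & unit4 x41 x42 x43 x44] /\
  [/\ unit4 x11 x21 x31 x41, unit4 x12 x22 x32 x42,
      unit4 x13 x23 x33 x43 & unit4 x14 x24 x34 x44].

Definition perm_rows (R : realType) (x11 x12 x13 x14 x21 x22 x23 x24
    x31 x32 x33 x34 x41 x42 x43 x44 : R) : Prop :=
  [/\ perm_eq [:: x11; x12; x13; x14] [:: x21; x22; x23; x24],
      perm_eq [:: x11; x12; x13; x14] [:: x31; x32; x33; x34] &
      perm_eq [:: x11; x12; x13; x14] [:: x41; x42; x43; x44]].

Lemma perm_cons_split (T : eqType) (x y : T) (s t u : seq T) :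
  x = y -> perm_eq s (t ++ u) -> perm_eq (x :: s) (t ++ y :: u).
Proof. by move=> -> st; rewrite perm_sym perm_catC perm_cons perm_catC perm_sym. Qed.

(** Backtracking search: the head on the left is tried against each entry on the right, with [ring]
    testing equality of linear forms; a later failure revises an earlier choice. *)
Ltac perm_search :=
  cbn [cat]; lazymatch goal with
  | |- is_true (perm_eq [::] [::]) => exact: perm_refl
  | |- is_true (perm_eq (_ :: _) [:: ?y1]) =>
      apply: (@perm_cons_split _ _ y1 _ [::] [::]); [ring | perm_search]
  | |- is_true (perm_eq (_ :: _) [:: ?y1; ?y2]) =>
      first [ apply: (@perm_cons_split _ _ y1 _ [::] [:: y2]); [ring | perm_search]
            | apply: (@perm_cons_split _ _ y2 _ [:: y1] [::]); [ring | perm_search]]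
  | |- is_true (perm_eq (_ :: _) [:: ?y1; ?y2; ?y3]) =>
      first [ apply: (@perm_cons_split _ _ y1 _ [::] [:: y2; y3]); [ring | perm_search]
            | apply: (@perm_cons_split _ _ y2 _ [:: y1] [:: y3]); [ring | perm_search]
            | apply: (@perm_cons_split _ _ y3 _ [:: y1; y2] [::]); [ring | perm_search]]
  | |- is_true (perm_eq (_ :: _) [:: ?y1; ?y2; ?y3; ?y4]) =>
      first [ apply: (@perm_cons_split _ _ y1 _ [::] [:: y2; y3; y4]); [ring | perm_search]
            | apply: (@perm_cons_split _ _ y2 _ [:: y1] [:: y3; y4]); [ring | perm_search]
            | apply: (@perm_cons_split _ _ y3 _ [:: y1; y2] [:: y4]); [ring | perm_search]
            | apply: (@perm_cons_split _ _ y4 _ [:: y1; y2; y3] [::]); [ring | perm_search]]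
  end.

Ltac match_rows := split; perm_search.

(* lra treats the monomials of multiplied-out products as atoms, so these
   tactics only need the relevant product to be a linear combination of the
   hypotheses. *)
Ltac eliminate v e := let E := fresh "E" in have E : v = e by [lra]; subst v.

Ltac eliminate_cancelling nz v e :=
  let E := fresh "E" in have E : v = e by [apply: (mulfI nz); lra]; subst v.

(** * Solving the norm equations in coordinates *)

(** Here and in the next three lemmas [a], [b], [c], [d] are the coefficients on $B_1$, [e], [f] on
    $B_2$, [g], [h] on $B_3$, [k] on $B_4$ and [m] on $B_5$; entries have the summand order that
    [expand_entries] produces. The squared norms of row and column 1 differ by $2g(a+f-d)$, those of
    row and column 3 by $2h(b+f-d)$, hence the split on [g] and [h]. *)
Lemma span23_perm_rows (R : realType) (a b c d e f g h : R) :
  unit_lines (b + e + h) (a + f + g) c d  (a + f) b (d + h) (c + e + g)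
             c d (a + e + g) (b + f + h)  (d + g) (c + e + h) (b + f) a ->
  perm_rows (b + e + h) (a + f + g) c d  (a + f) b (d + h) (c + e + g)
            c d (a + e + g) (b + f + h)  (d + g) (c + e + h) (b + f) a.
Proof.
case=> [[r1 r2 r3 r4] [k1 k2 k3 k4]].
have [g0|gN] := eqVneq g 0; have [h0|hN] := eqVneq h 0.
- subst g h; have [e0|eN] := eqVneq e 0.
    subst e; have [f0|fN] := eqVneq f 0; first by subst f; match_rows.
    by eliminate_cancelling fN b a; match_rows.
  by eliminate_cancelling eN c b; eliminate_cancelling eN b a; match_rows.
- subst g; eliminate_cancelling hN d (b + f).
  eliminate_cancelling hN c (b + f - e).
  have [f0|fN] := eqVneq f 0.
    subst f; have [e0|eN] := eqVneq e 0; first by subst e; match_rows.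
    eliminate_cancelling eN a (b - e).
    by eliminate_cancelling eN h (- e); match_rows.
  eliminate_cancelling fN b a.
  have [e0|eN] := eqVneq e 0.
    (* With [e] zero, equal norms of rows 1 and 2 force $fh = 0$. *)
    by subst e; case/eqP: fN; apply: (mulfI hN); lra.
  by eliminate_cancelling eN f e; match_rows.
- subst h; eliminate_cancelling gN d (a + f).
  eliminate_cancelling gN c (a + f - e).
  have [f0|fN] := eqVneq f 0.
    subst f; have [e0|eN] := eqVneq e 0; first by subst e; match_rows.
    eliminate_cancelling eN b (a - e).
    by eliminate_cancelling eN g (- e); match_rows.
  eliminate_cancelling fN b a.
  have [e0|eN] := eqVneq e 0.
    by subst e; case/eqP: fN; apply: (mulfI gN); lra.
  by eliminate_cancelling eN f e; match_rows.
eliminate_cancelling gN d (a + f).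
eliminate_cancelling hN b a.
(* Row and column 2 now give $(g-h)(c+e-a-f) = 0$. *)
have [gh|ghN] := eqVneq (g - h) 0.
  eliminate g h; have [eh|ehN] := eqVneq (e + h) 0.
    by eliminate h (- e); match_rows.
  by eliminate_cancelling ehN c a; match_rows.
eliminate_cancelling ghN c (a + f - e).
have [ef|efN] := eqVneq (e - f) 0; first by eliminate e f; match_rows.
(* This branch is contradictory, as [g] and [h] both become [- e]; the rows match after
   substitution, which closes it all the same. *)
eliminate_cancelling efN g (- e).
by eliminate_cancelling efN h (- e); match_rows.
Qed.

(** Row minus column gives $2k(a+f-c)$ for index 1 and $2k(d-a-f)$ for index 2, so a nonzero [k]
    fixes both [c] and [d]. *)
Lemma span24_perm_rows (R : realType) (a b c d e f k : R) :
  unit_lines (b + e) (a + f + k) c d  (a + f) b (d + k) (c + e)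
             (c + k) d (a + e) (b + f)  d (c + e) (b + f) (a + k) ->
  perm_rows (b + e) (a + f + k) c d  (a + f) b (d + k) (c + e)
            (c + k) d (a + e) (b + f)  d (c + e) (b + f) (a + k).
Proof.
case=> [[r1 r2 r3 r4] [k1 k2 k3 k4]].
have [k0|kN] := eqVneq k 0.
  subst k; have [e0|eN] := eqVneq e 0.
    subst e; have [f0|fN] := eqVneq f 0; first by subst f; match_rows.
    by eliminate_cancelling fN b a; match_rows.
  by eliminate_cancelling eN c b; eliminate_cancelling eN b a; match_rows.
eliminate_cancelling kN c (a + f).
eliminate_cancelling kN d (a + f).
have [e0|eN] := eqVneq e 0.
  subst e; have [f0|fN] := eqVneq f 0; first by subst f; match_rows.
  eliminate_cancelling fN b a.
  (* Rows 3 and 4 now differ in squared norm by $2kf$. *)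
  by case/eqP: kN; apply: (mulfI fN); lra.
eliminate_cancelling eN b (a + f).
have [f0|fN] := eqVneq f 0; first by subst f; match_rows.
by eliminate_cancelling fN e f; eliminate_cancelling fN k f; match_rows.
Qed.

(** Row minus column gives $2g(a-d)$ for index 1 and $2h(b-d-m)$ for index 3. *)
Lemma span35_perm_rows (R : realType) (a b c d g h m : R) :
  unit_lines (b + h + m) (a + g) c d  a b (d + h + m) (c + g)
             c (d + m) (a + g) (b + h)  (d + g) (c + h) b (a + m) ->
  perm_rows (b + h + m) (a + g) c d  a b (d + h + m) (c + g)
            c (d + m) (a + g) (b + h)  (d + g) (c + h) b (a + m).
Proof.
case=> [[r1 r2 r3 r4] [k1 k2 k3 k4]].
have [g0|gN] := eqVneq g 0; have [h0|hN] := eqVneq h 0.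
- subst g h; have [m0|mN] := eqVneq m 0; first by subst m; match_rows.
  by eliminate_cancelling mN b d; eliminate_cancelling mN d a; match_rows.
- subst g; eliminate_cancelling hN b (d + m).
  eliminate_cancelling hN c (d + m).
  have [m0|mN] := eqVneq m 0; first by subst m; match_rows.
  by eliminate_cancelling mN h (- m); eliminate_cancelling mN d a; match_rows.
- subst h; eliminate_cancelling gN d a; eliminate_cancelling gN c a.
  have [m0|mN] := eqVneq m 0; first by subst m; match_rows.
  by eliminate_cancelling mN b a; match_rows.
eliminate_cancelling gN d a; eliminate_cancelling hN b (a + m).
eliminate_cancelling gN c a.
have [m0|mN] := eqVneq m 0; first by subst m; match_rows.
(* Rows 3 and 4 now differ by $2hm$, so [g], [h], [m] cannot all be nonzero. *)
by case/eqP: mN; apply: (mulfI hN); lra.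
Qed.

Lemma span45_perm_rows (R : realType) (a b c d k m : R) :
  unit_lines (b + m) (a + k) c d  a b (d + k + m) c
             (c + k) (d + m) a b  d c b (a + k + m) ->
  perm_rows (b + m) (a + k) c d  a b (d + k + m) c
            (c + k) (d + m) a b  d c b (a + k + m).
Proof.
case=> [[r1 r2 r3 r4] [k1 k2 k3 k4]].
have [k0|kN] := eqVneq k 0; have [m0|mN] := eqVneq m 0.
- by subst k m; match_rows.
- by subst k; eliminate_cancelling mN b d; eliminate_cancelling mN a d; match_rows.
- by subst m; eliminate_cancelling kN c a; eliminate_cancelling kN a d; match_rows.
eliminate_cancelling kN c a; eliminate_cancelling mN b d.
eliminate_cancelling mN d (a + k).
by eliminate_cancelling kN m (- k); match_rows.
Qed.

(** * From matrices to coordinates and back *)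

(** Coefficients are indexed by [nat] so that a new generator merely shifts them; the default [1%g]
    is never reached, as [k < size s]. *)
Lemma mem_span_perm_mx (R : realType) (s : seq 'S_4) (A : 'M[R]_4) :
  A \in <<[seq (perm_mx t : 'M[R]_4) | t <- s]>>%VS ->
  exists x : nat -> R, forall i j,
    A i j = \sum_(k < size s) x k * (nth 1%g s k i == j)%:R.
Proof.
elim: s A => [|t s IHs] A /=.
  rewrite span_nil memv0 => /eqP->; exists (fun=> 0) => i j.
  by rewrite big_ord0 mxE.
rewrite span_cons => /memv_addP[B /vlineP[c ->] [C /IHs[x Cx] ->]].
exists (fun k => if k is k'.+1 then x k' else c) => i j.
by rewrite big_ord_recl !mxE Cx.
Qed.

Lemma unit_lines_orthogonal (R : realType) (A : 'M[R]_4) :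
  orthogonal_mx A ->
  unit_lines (A p1 p1) (A p1 p2) (A p1 p3) (A p1 p4)
             (A p2 p1) (A p2 p2) (A p2 p3) (A p2 p4)
             (A p3 p1) (A p3 p2) (A p3 p3) (A p3 p4)
             (A p4 p1) (A p4 p2) (A p4 p3) (A p4 p4).
Proof.
(* A one-sided inverse of a square matrix is two-sided, so rows are unit vectors as well as
   columns. *)
move=> AtA; have AAt : A *m A^T = 1%:M by exact: mulmx1C.
have row1 i : A i p1 * A i p1 + A i p2 * A i p2 + A i p3 * A i p3
    + A i p4 * A i p4 = 1.
  have := congr1 (fun B : 'M[R]_4 => B i i) AAt.
  rewrite !mxE eqxx !big_ord_recr big_ord0 /= !mxE add0r mulr1n => <-.
  (* The indices coming from [big_ord_recr] agree with [p1], ..., [p4] in value only. *)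
  by do ![congr (_ + _)]; congr (A _ _ * A _ _); apply: val_inj.
have col1 j : A p1 j * A p1 j + A p2 j * A p2 j + A p3 j * A p3 j
    + A p4 j * A p4 j = 1.
  have := congr1 (fun B : 'M[R]_4 => B j j) AtA.
  rewrite !mxE eqxx !big_ord_recr big_ord0 /= !mxE add0r mulr1n => <-.
  by do ![congr (_ + _)]; congr (A _ _ * A _ _); apply: val_inj.
by do 2!split.
Qed.

Lemma permutative_perm_rows (R : realType) (A : 'M[R]_4) :
  perm_rows (A p1 p1) (A p1 p2) (A p1 p3) (A p1 p4)
            (A p2 p1) (A p2 p2) (A p2 p3) (A p2 p4)
            (A p3 p1) (A p3 p2) (A p3 p3) (A p3 p4)
            (A p4 p1) (A p4 p2) (A p4 p3) (A p4 p4) ->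
  permutative A.
Proof.
case=> r2 r3 r4.
pose rows i := [tuple A i p1; A i p2; A i p3; A i p4].
have ord4 (i : 'I_4) : i \in [:: p1; p2; p3; p4].
  by case: i => [[|[|[|[|]]]]].
have rowsE i j : tnth (rows i) j = A i j.
  by case/or4P: (ord4 j) => [||| /orP[]//] /eqP->; rewrite (tnth_nth 0).
have p1_rows i : perm_eq (rows p1) (rows i).
  by case/or4P: (ord4 i) => [||| /orP[]//] /eqP->.
move=> i j.
(* Two arbitrary rows are compared through the first one. *)
have /tuple_permP[s es] : perm_eq (rows i) (rows j).
  by rewrite -(permPl (p1_rows i)).
exists s; apply/rowP => k; rewrite !mxE -!rowsE.
by rewrite (tnth_nth 0) es -tnth_nth tnth_mktuple.
Qed.

Lemma coords_L (R : realType) (i j : nat) (A : 'M[R]_4) :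
  A \in (L R 1 + L R i + L R j)%VS ->
  let s := Bperms 1 ++ Bperms i ++ Bperms j in
  exists x : nat -> R, forall i j,
    A i j = \sum_(k < size s) x k * (nth 1%g s k i == j)%:R.
Proof.
rewrite /L -!span_cat -!map_cat -catA => As.
exact: mem_span_perm_mx.
Qed.

(* Evaluating the permutations once, at a generic index, is much faster than
   doing so in each of the 16 entries. *)
Ltac expand_entries Ax :=
  let E := fresh "E" in let i := fresh "i" in let j := fresh "j" in
  eassert (E : forall i j, _ i j = _);
    [ move=> i j; apply: etrans (Ax i j) _;
      rewrite /= !big_ord_recr big_ord0 /= /cyc3 ?permM !permE /=; reflexivity
    | rewrite !E /= !mulr0 !mulr1 !addr0 !add0r ].

Lemma permutative_L (R : realType) (i j : nat) (A : 'M[R]_4) :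
  (i, j) \in [:: (2, 3); (2, 4); (3, 5); (4, 5)]%N ->
  A \in (L R 1 + L R i + L R j)%VS -> orthogonal_mx A -> permutative A.
Proof.
move=> hij /coords_L[x Ax] /unit_lines_orthogonal A1.
apply: permutative_perm_rows; move: A1.
case/or4P: hij Ax => [/eqP[-> ->]|/eqP[-> ->]|/eqP[-> ->]|/orP[/eqP[-> ->]|//]] Ax.
- by expand_entries Ax; apply: span23_perm_rows.
- by expand_entries Ax; apply: span24_perm_rows.
- by expand_entries Ax; apply: span35_perm_rows.
- by expand_entries Ax; apply: span45_perm_rows.
Qed.

Theorem theorem3p8 (R : realType) (i j : nat) (A : 'M[R]_4)
  (hi : i \in [:: 2; 3; 4; 5]%N) (hj : j \in [:: 2; 3; 4; 5]%N)
  (hij : i <> j)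
  (h25 : ~~ perm_eq [:: i; j] [:: 2; 5]%N)
  (h34 : ~~ perm_eq [:: i; j] [:: 3; 4]%N)
  (hA : A \in (L R 1 + L R i + L R j)%VS)
  (hO : orthogonal_mx A) :
  OP4 A.
Proof.
(* The exclusions leave four unordered pairs, found by running through all sixteen ordered ones; the
   reversed order is handled by commutativity of the sum of subspaces. *)
split=> //; have /orP[ij|ji] : ((i, j) \in [:: (2, 3); (2, 4); (3, 5); (4, 5)]%N)
    || ((j, i) \in [:: (2, 3); (2, 4); (3, 5); (4, 5)]%N).
- move: hi hj hij h25 h34 {hA}; rewrite !inE.
  by do 2![case/or4P=> /eqP->].
- exact: permutative_L ij hA hO.
- by apply: permutative_L ji _ hO; rewrite -addvA (addvC (L R j)) addvA.
Qed.
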